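(* Let $(\mathcal{E},\otimes)$ be a locally subcartesian category. Then for every object $B$ the slice category $\mathcal{E}/B$ is a subcartesian monoidal category with tensor $u\otimes_B v:=\Sigma_v\nabla_v(u)$. Moreover, the affine base change functors $\nabla_p$ respect this monoidal structure, thus giving an indexed monoidal category (pseudofunctor) $\nabla_{(-)}\colon\mathcal{E}^{\mathrm{op}}\to\mathbf{MonCat}$, $B\mapsto(\mathcal{E}/B,\otimes_B,\mathrm{id}_B)$.
   Context: A commuting square $fg'=gf'$ on a cospan $f\colon A\to X$, $g\colon B\to X$ is subcartesian if the pair $(g',f')$ is jointly monic. A locally subcartesian category $(\mathcal{E},\otimes)$ is a category $\mathcal{E}$ with, for each cospan $f\colon A\to X$, $g\colon B\to X$, a chosen subcartesian square with apex $A\otimes_X B$ and projections $g'\colon A\otimes_X B\to A$, $f'\colon A\otimes_X B\to B$, subject to: (symmetry) there are isomorphisms $A\otimes_X B\cong B\otimes_X A$ commuting with the projections; (nullary) if $g$ is an identity then so is $g'$; (binary) for $p\colon W\to Y$, $q\colon Y\to Z$, $g\colon B\to Z$, with $g'\colon Y\otimes_Z B\to Y$, pasting the chosen square of $(p,g')$ with the chosen square of $(q,g)$ gives a square isomorphic, compatibly with the projections to $W$ and $B$, to the chosen square of $(qp,g)$. For $f\colon X\to Y$, $\Sigma_f\colon\mathcal{E}/X\to\mathcal{E}/Y$ is composition with $f$, and $\nabla_f\colon\mathcal{E}/Y\to\mathcal{E}/X$ sends $h\colon H\to Y$ to the projection $X\otimes_Y H\to X$ and sends $u\colon h\to h_1$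 to the unique morphism $X\otimes_Y H\to X\otimes_Y H_1$ over $X$ compatible with $u$ and the projections to $H,H_1$. These form a pseudofunctor $\mathcal{E}^{\mathrm{op}}\to\mathbf{Cat}$. A (symmetric) subcartesian monoidal category $(\mathcal{C},\otimes,I)$ consists of a bifunctor $\otimes\colon\mathcal{C}\times\mathcal{C}\to\mathcal{C}$, an object $I$, projections $\pi_1^{A,B}\colon A\otimes B\to A$ and $\pi_2^{A,B}\colon A\otimes B\to B$, and isomorphisms $\theta^A\colon A\cong A\otimes I$, $\phi^A\colon A\cong I\otimes A$, $\alpha^{A,B,C}\colon(A\otimes B)\otimes C\cong A\otimes(B\otimes C)$, $\gamma^{A,B}\colon A\otimes B\cong B\otimes A$ such that: (1) $\pi_1^{A,B},\pi_2^{A,B}$ are jointly monic; (2) the projections are natural: $\pi_1(f\otimes g)=f\pi_1$ and $\pi_2(f\otimes g)=g\pi_2$; (3) $\pi_1^{A,I}\theta^A=\mathrm{id}_A$ and $\pi_2^{I,B}\phi^B=\mathrm{id}_B$; (4) $(A\otimes\pi_1^{B,C})\alpha^{A,B,C}=\pi_1^{A\otimes B,C}$ and $\pi_2^{A,B\otimes C}\alpha^{A,B,C}=\pi_2^{A,B}\otimes C$; (5) $\pi_1^{B,A}\gamma^{A,B}=\pi_2^{A,B}$ and $\pi_2^{B,A}\gamma^{A,B}=\pi_1^{A,B}$. $\mathbf{MonCat}$ is the 2-category of monoidal categories, strong monoidal functors and monoidal natural transformations. *)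

(* Defs.v *)
From Stdlib Require Import IndefiniteDescription ProofIrrelevance.

Set Implicit Arguments.
Unset Strict Implicit.
Unset Printing Implicit Defensive.

Declare Scope cat_scope.
Delimit Scope cat_scope with cat.
Local Open Scope cat_scope.

Record Category := {
  Obj :> Type;
  Hom : Obj -> Obj -> Type;
  idm : forall a, Hom a a;
  comp : forall a b c, Hom b c -> Hom a b -> Hom a c;
  comp_id_l : forall a b (f : Hom a b), comp (idm b) f = f;
  comp_id_r : forall a b (f : Hom a b), comp f (idm a) = f;
  comp_assoc : forall a b c d (h : Hom c d) (g : Hom b c) (f : Hom a b),
    comp h (comp g f) = comp (comp h g) f
}.

Arguments Hom {_} _ _.
Arguments idm {_} _.
Notation "g ∘ f" := (comp g f) (at level 40, left associativity) : cat_scope.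

Definition op (C : Category) : Category := {|
  Obj := C;
  Hom := fun a b => @Hom C b a;
  idm := fun a => idm a;
  comp := fun a b c g f => f ∘ g;
  comp_id_l := fun a b f => comp_id_r f;
  comp_id_r := fun a b f => comp_id_l f;
  comp_assoc := fun a b c d h g f => eq_sym (comp_assoc f g h)
|}.

Definition is_iso (C : Category) (a b : C) (f : Hom a b) : Prop :=
  exists g : Hom b a, f ∘ g = idm b /\ g ∘ f = idm a.

(* [is_identity f]: the endpoints of [f] are the same object and [f] is its
   identity. *)
Inductive is_identity (C : Category) : forall a b : C, Hom a b -> Prop :=
  is_identity_idm : forall a : C, is_identity (idm a).

Definition jointly_monic (C : Category) (P A B : C)
    (p : Hom P A) (q : Hom P B) : Prop :=
  forall (Z : C) (s t : Hom Z P), p ∘ s = p ∘ t -> q ∘ s = q ∘ t -> s = t.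

Record Functor (C D : Category) := {
  fobj :> C -> D;
  fmap : forall a b, Hom a b -> Hom (fobj a) (fobj b);
  fmap_id : forall a, fmap (idm a) = idm (fobj a);
  fmap_comp : forall a b c (g : Hom b c) (f : Hom a b),
    fmap (g ∘ f) = fmap g ∘ fmap f
}.

Arguments fmap {C D} _ {a b} _.

Definition functor_id (C : Category) : Functor C C := {|
  fobj := fun a => a;
  fmap := fun a b f => f;
  fmap_id := fun a => eq_refl;
  fmap_comp := fun a b c g f => eq_refl
|}.

Definition functor_comp (C D E : Category) (G : Functor D E) (F : Functor C D) :
  Functor C E.
Proof.
refine {| fobj := fun a => G (F a); fmap := fun a b f => fmap G (fmap F f) |}.
- intros a; now rewrite !fmap_id.
- intros a b c g f; now rewrite !fmap_comp.
Defined.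

Record SliceObj (E : Category) (B : E) := { dom : E; arr : Hom dom B }.

Record SliceHom (E : Category) (B : E) (u v : SliceObj B) := {
  mor :> Hom (dom u) (dom v);
  mor_over : arr v ∘ mor = arr u
}.

Lemma SliceHom_eq (E : Category) (B : E) (u v : SliceObj B)
    (s t : SliceHom u v) : mor s = mor t -> s = t.
Proof.
destruct s as [s hs], t as [t ht]; simpl; intros ->.
f_equal; apply proof_irrelevance.
Qed.

Definition Slice (E : Category) (B : E) : Category.
Proof.
unshelve refine {|
  Obj := SliceObj B;
  Hom := @SliceHom E B;
  idm := fun u => {| mor := idm (dom u) |};
  comp := fun u v w t s => {| mor := mor t ∘ mor s |}
|}.
- apply comp_id_r.
- now rewrite comp_assoc, !mor_over.
- intros; apply SliceHom_eq, comp_id_l.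
- intros; apply SliceHom_eq, comp_id_r.
- intros; apply SliceHom_eq, comp_assoc.
Defined.

Definition slice_id (E : Category) (B : E) : Slice B :=
  {| dom := B; arr := idm B |}.

Definition Sigma_obj (E : Category) (X Y : E) (f : Hom X Y) (u : Slice X) :
  Slice Y := {| dom := dom u; arr := f ∘ arr u |}.

Definition Sigma (E : Category) (X Y : E) (f : Hom X Y) :
  Functor (Slice X) (Slice Y).
Proof.
unshelve refine (@Build_Functor (Slice X) (Slice Y)
  (Sigma_obj f)
  (fun u v s => @Build_SliceHom E Y (Sigma_obj f u) (Sigma_obj f v) (mor s) _)
  _ _).
- simpl; now rewrite <- comp_assoc, mor_over.
- intros; now apply SliceHom_eq.
- intros; now apply SliceHom_eq.
Defined.

Record SubcartesianSquare (E : Category) (A B X : E)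
    (f : Hom A X) (g : Hom B X) := {
  apex : E;
  pr1 : Hom apex A;
  pr2 : Hom apex B;
  square_comm : f ∘ pr1 = g ∘ pr2;
  square_monic : jointly_monic pr1 pr2
}.

Record LocallySubcartesian (E : Category) := {
  sq : forall (A B X : E) (f : Hom A X) (g : Hom B X), SubcartesianSquare f g;
  sq_symmetry : forall (A B X : E) (f : Hom A X) (g : Hom B X),
    exists i : Hom (apex (sq f g)) (apex (sq g f)),
      is_iso i /\
      pr1 (sq g f) ∘ i = pr2 (sq f g) /\
      pr2 (sq g f) ∘ i = pr1 (sq f g);
  sq_nullary : forall (A B X : E) (f : Hom A X) (g : Hom B X),
    is_identity g -> is_identity (pr1 (sq f g));
  sq_binary : forall (W Y Z B : E)
      (p : Hom W Y) (q : Hom Y Z) (g : Hom B Z),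
    exists i : Hom (apex (sq p (pr1 (sq q g)))) (apex (sq (q ∘ p) g)),
      is_iso i /\
      pr1 (sq (q ∘ p) g) ∘ i = pr1 (sq p (pr1 (sq q g))) /\
      pr2 (sq (q ∘ p) g) ∘ i = pr2 (sq q g) ∘ pr2 (sq p (pr1 (sq q g)))
}.

Lemma nabla_mor_exists (E : Category) (T : LocallySubcartesian E) (X Y : E)
    (f : Hom X Y) (h h1 : Slice Y) (u : Hom h h1) :
  exists m : Hom (apex (sq T f (arr h))) (apex (sq T f (arr h1))),
    pr1 (sq T f (arr h1)) ∘ m = pr1 (sq T f (arr h)) /\
    pr2 (sq T f (arr h1)) ∘ m = mor u ∘ pr2 (sq T f (arr h)).
Proof.
destruct h as [H h], h1 as [H1 h1], u as [u hu]; simpl in *; subst h.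
destruct (sq_binary T u h1 f) as [i [[j [ij _]] [i1 i2]]].
destruct (sq_symmetry T f (h1 ∘ u)) as [s [_ [s1 s2]]].
destruct (sq_symmetry T h1 f) as [t [_ [t1 t2]]].
exists (t ∘ (pr2 (sq T u (pr1 (sq T h1 f))) ∘ (j ∘ s))); split.
- rewrite comp_assoc, t1, comp_assoc, <- i2, <- comp_assoc.
  now rewrite (comp_assoc i), ij, comp_id_l.
- rewrite comp_assoc, t2, comp_assoc.
  rewrite <- (square_comm (sq T u (pr1 (sq T h1 f)))), <- i1, <- s1.
  now rewrite <- !comp_assoc, (comp_assoc i j), ij, comp_id_l.
Qed.

Definition nabla_mor_sig (E : Category) (T : LocallySubcartesian E) (X Y : E)
    (f : Hom X Y) (h h1 : Slice Y) (u : Hom h h1) :=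
  constructive_indefinite_description _ (nabla_mor_exists T f u).

(* The description operator picks a morphism that is unique, the projections
   out of a chosen square being jointly monic. *)
Definition nabla_mor (E : Category) (T : LocallySubcartesian E) (X Y : E)
    (f : Hom X Y) (h h1 : Slice Y) (u : Hom h h1) :
    Hom (apex (sq T f (arr h))) (apex (sq T f (arr h1))) :=
  proj1_sig (nabla_mor_sig T f u).

Lemma nabla_mor_pr1 (E : Category) (T : LocallySubcartesian E) (X Y : E)
    (f : Hom X Y) (h h1 : Slice Y) (u : Hom h h1) :
  pr1 (sq T f (arr h1)) ∘ nabla_mor T f u = pr1 (sq T f (arr h)).
Proof. exact (proj1 (proj2_sig (nabla_mor_sig T f u))). Qed.

Lemma nabla_mor_pr2 (E : Category) (T : LocallySubcartesian E) (X Y : E)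
    (f : Hom X Y) (h h1 : Slice Y) (u : Hom h h1) :
  pr2 (sq T f (arr h1)) ∘ nabla_mor T f u = mor u ∘ pr2 (sq T f (arr h)).
Proof. exact (proj2 (proj2_sig (nabla_mor_sig T f u))). Qed.

Definition nabla_obj (E : Category) (T : LocallySubcartesian E) (X Y : E)
    (f : Hom X Y) (h : Slice Y) : Slice X :=
  {| dom := apex (sq T f (arr h)); arr := pr1 (sq T f (arr h)) |}.

Definition nabla (E : Category) (T : LocallySubcartesian E) (X Y : E)
    (f : Hom X Y) : Functor (Slice Y) (Slice X).
Proof.
unshelve refine (@Build_Functor (Slice Y) (Slice X)
  (nabla_obj T f)
  (fun h h1 u => @Build_SliceHom E X (nabla_obj T f h) (nabla_obj T f h1)
     (nabla_mor T f u) _)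
  _ _).
- exact (nabla_mor_pr1 T f u).
- intros h; apply SliceHom_eq; simpl.
  apply (square_monic (s := sq T f (arr h))).
  + rewrite nabla_mor_pr1; symmetry; apply comp_id_r.
  + rewrite nabla_mor_pr2; simpl; now rewrite comp_id_l, comp_id_r.
- intros a b c t s; apply SliceHom_eq; simpl.
  apply (square_monic (s := sq T f (arr c))).
  + now rewrite nabla_mor_pr1, (comp_assoc (pr1 _)), !nabla_mor_pr1.
  + rewrite nabla_mor_pr2, (comp_assoc (pr2 _)), nabla_mor_pr2; simpl.
    now rewrite <- !comp_assoc, nabla_mor_pr2.
Defined.

(* The tensor product of objects and the unit are parameters; [tmor] is the
   action of the bifunctor on morphisms. *)
Record SubcartesianMonoidal (C : Category) (tens : C -> C -> C) (I : C) := {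
  tmor : forall a a' b b' : C,
    Hom a a' -> Hom b b' -> Hom (tens a b) (tens a' b');
  tmor_id : forall a b, tmor (idm a) (idm b) = idm (tens a b);
  tmor_comp : forall (a a' a'' b b' b'' : C)
      (f' : Hom a' a'') (f : Hom a a') (g' : Hom b' b'') (g : Hom b b'),
    tmor (f' ∘ f) (g' ∘ g) = tmor f' g' ∘ tmor f g;
  pi1 : forall a b, Hom (tens a b) a;
  pi2 : forall a b, Hom (tens a b) b;
  theta : forall a, Hom a (tens a I);
  phi : forall a, Hom a (tens I a);
  alpha : forall a b c, Hom (tens (tens a b) c) (tens a (tens b c));
  gamma : forall a b, Hom (tens a b) (tens b a);
  theta_iso : forall a, is_iso (theta a);
  phi_iso : forall a, is_iso (phi a);
  alpha_iso : forall a b c, is_iso (alpha a b c);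
  gamma_iso : forall a b, is_iso (gamma a b);
  pi_monic : forall a b, jointly_monic (pi1 a b) (pi2 a b);
  pi1_nat : forall (a a' b b' : C) (f : Hom a a') (g : Hom b b'),
    pi1 a' b' ∘ tmor f g = f ∘ pi1 a b;
  pi2_nat : forall (a a' b b' : C) (f : Hom a a') (g : Hom b b'),
    pi2 a' b' ∘ tmor f g = g ∘ pi2 a b;
  pi1_theta : forall a, pi1 a I ∘ theta a = idm a;
  pi2_phi : forall b, pi2 I b ∘ phi b = idm b;
  pi1_alpha : forall a b c,
    tmor (idm a) (pi1 b c) ∘ alpha a b c = pi1 (tens a b) c;
  pi2_alpha : forall a b c,
    pi2 a (tens b c) ∘ alpha a b c = tmor (pi2 a b) (idm c);
  pi1_gamma : forall a b, pi1 b a ∘ gamma a b = pi2 a b;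
  pi2_gamma : forall a b, pi2 b a ∘ gamma a b = pi1 a b
}.

Record MonoidalCategory := {
  mcat :> Category;
  mten : mcat -> mcat -> mcat;
  munit : mcat;
  mtmor : forall a a' b b' : mcat,
    Hom a a' -> Hom b b' -> Hom (mten a b) (mten a' b');
  mtmor_id : forall a b, mtmor (idm a) (idm b) = idm (mten a b);
  mtmor_comp : forall (a a' a'' b b' b'' : mcat)
      (f' : Hom a' a'') (f : Hom a a') (g' : Hom b' b'') (g : Hom b b'),
    mtmor (f' ∘ f) (g' ∘ g) = mtmor f' g' ∘ mtmor f g;
  massoc : forall a b c, Hom (mten (mten a b) c) (mten a (mten b c));
  mlunit : forall a, Hom (mten munit a) a;
  mrunit : forall a, Hom (mten a munit) a;
  massoc_iso : forall a b c, is_iso (massoc a b c);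
  mlunit_iso : forall a, is_iso (mlunit a);
  mrunit_iso : forall a, is_iso (mrunit a);
  massoc_nat : forall (a a' b b' c c' : mcat)
      (f : Hom a a') (g : Hom b b') (h : Hom c c'),
    massoc a' b' c' ∘ mtmor (mtmor f g) h =
    mtmor f (mtmor g h) ∘ massoc a b c;
  mlunit_nat : forall (a a' : mcat) (f : Hom a a'),
    mlunit a' ∘ mtmor (idm munit) f = f ∘ mlunit a;
  mrunit_nat : forall (a a' : mcat) (f : Hom a a'),
    mrunit a' ∘ mtmor f (idm munit) = f ∘ mrunit a;
  mtriangle : forall a b,
    mtmor (idm a) (mlunit b) ∘ massoc a munit b = mtmor (mrunit a) (idm b);
  mpentagon : forall a b c d,
    massoc a b (mten c d) ∘ massoc (mten a b) c d =
    mtmor (idm a) (massoc b c d) ∘ massoc a (mten b c) d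
      ∘ mtmor (massoc a b c) (idm d)
}.

Arguments mten {_} _ _.
Arguments mtmor {_} {_ _ _ _} _ _.
Arguments massoc {_} _ _ _.
Arguments mlunit {_} _.
Arguments mrunit {_} _.

Lemma comp_cong_r (C : Category) (z a b b' c : C) (x : Hom b c) (y : Hom a b)
    (x' : Hom b' c) (y' : Hom a b') :
  x ∘ y = x' ∘ y' -> forall t : Hom z a, x ∘ (y ∘ t) = x' ∘ (y' ∘ t).
Proof. intros e t; now rewrite !comp_assoc, e. Qed.

Lemma comp_cong_r1 (C : Category) (z a b c : C) (x : Hom b c) (y : Hom a b)
    (x' : Hom a c) :
  x ∘ y = x' -> forall t : Hom z a, x ∘ (y ∘ t) = x' ∘ t.
Proof. intros e t; now rewrite comp_assoc, e. Qed.

Lemma is_iso_retraction (C : Category) (a b : C) (f : Hom a b) (r : Hom b a) :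
  is_iso f -> r ∘ f = idm a -> is_iso r.
Proof.
intros [g [fg gf]] rf; exists f; split; [exact rf|].
assert (rg : r = g).
{ now rewrite <- (comp_id_r r), <- fg, comp_assoc, rf, comp_id_l. }
now rewrite rg.
Qed.

Lemma alpha_pr1 (C : Category) (tens : C -> C -> C) (I : C)
    (S : SubcartesianMonoidal tens I) (a b c : C) :
  pi1 S a (tens b c) ∘ alpha S a b c = pi1 S a b ∘ pi1 S (tens a b) c.
Proof.
rewrite <- (pi1_alpha S a b c), comp_assoc, pi1_nat; now rewrite comp_id_l.
Qed.

Lemma pi_monic3 (C : Category) (tens : C -> C -> C) (I : C)
    (S : SubcartesianMonoidal tens I) (z a b c : C)
    (s t : Hom z (tens a (tens b c))) :
  pi1 S a (tens b c) ∘ s = pi1 S a (tens b c) ∘ t ->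
  pi1 S b c ∘ (pi2 S a (tens b c) ∘ s) = pi1 S b c ∘ (pi2 S a (tens b c) ∘ t) ->
  pi2 S b c ∘ (pi2 S a (tens b c) ∘ s) = pi2 S b c ∘ (pi2 S a (tens b c) ∘ t) ->
  s = t.
Proof. intros h1 h2 h3; apply (pi_monic (s := S)); auto; now apply (pi_monic (s := S)). Qed.

Ltac project :=
  rewrite <- ?comp_assoc;
  repeat (first
    [ rewrite alpha_pr1 | rewrite (comp_cong_r (alpha_pr1 _ _ _ _))
    | rewrite pi2_alpha | rewrite (comp_cong_r1 (pi2_alpha _ _ _ _))
    | rewrite pi1_nat | rewrite (comp_cong_r (pi1_nat _ _ _))
    | rewrite pi2_nat | rewrite (comp_cong_r (pi2_nat _ _ _))
    | rewrite comp_id_l | rewrite comp_id_r ];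
    rewrite <- ?comp_assoc);
  try reflexivity.

(* The underlying monoidal category. By the unit axioms the projections
   [I ⊗ a -> a] and [a ⊗ I -> a] are the inverses of [phi] and [theta]. *)
Definition monoidal_of (C : Category) (tens : C -> C -> C) (I : C)
    (S : SubcartesianMonoidal tens I) : MonoidalCategory.
Proof.
refine {|
  mcat := C;
  mten := tens;
  munit := I;
  mtmor := @tmor C tens I S;
  mtmor_id := tmor_id S;
  mtmor_comp := @tmor_comp C tens I S;
  massoc := alpha S;
  mlunit := pi2 S I;
  mrunit := fun a => pi1 S a I;
  massoc_iso := alpha_iso S
|}.
- intros a; apply (is_iso_retraction (phi_iso S a)), pi2_phi.
- intros a; apply (is_iso_retraction (theta_iso S a)), pi1_theta.
- intros a a' b b' c c' f g h; apply (pi_monic3 (S := S)); project.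
- intros; apply pi2_nat.
- intros; apply pi1_nat.
- intros a b; apply (pi_monic (s := S)); project.
- intros a b c d; apply (pi_monic3 (S := S)).
  + project.
  + project.
  + apply (pi_monic (s := S)); project.
Defined.

Record StrongMonoidal (M N : MonoidalCategory) (F : Functor M N) := {
  smul : forall a b : M, Hom (mten (F a) (F b)) (F (mten a b));
  sunit : Hom (munit N) (F (munit M));
  smul_iso : forall a b, is_iso (smul a b);
  sunit_iso : is_iso sunit;
  smul_nat : forall (a a' b b' : M) (f : Hom a a') (g : Hom b b'),
    smul a' b' ∘ mtmor (fmap F f) (fmap F g) = fmap F (mtmor f g) ∘ smul a b;
  smul_assoc : forall a b c,
    fmap F (massoc a b c) ∘ smul (mten a b) c ∘ mtmor (smul a b) (idm (F c)) =
    smul a (mten b c) ∘ mtmor (idm (F a)) (smul b c)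
      ∘ massoc (F a) (F b) (F c);
  smul_lunit : forall a,
    fmap F (mlunit a) ∘ smul (munit M) a ∘ mtmor sunit (idm (F a)) =
    mlunit (F a);
  smul_runit : forall a,
    fmap F (mrunit a) ∘ smul a (munit M) ∘ mtmor (idm (F a)) sunit =
    mrunit (F a)
}.

Record MonFunctor (M N : MonoidalCategory) := {
  mfun :> Functor M N;
  mstrong : StrongMonoidal mfun
}.

Lemma is_iso_idm (C : Category) (a : C) : is_iso (idm a).
Proof. exists (idm a); split; apply comp_id_l. Qed.

Lemma is_iso_comp (C : Category) (a b c : C) (g : Hom b c) (f : Hom a b) :
  is_iso g -> is_iso f -> is_iso (g ∘ f).
Proof.
intros [g' [g1 g2]] [f' [f1 f2]]; exists (f' ∘ g'); split.
- now rewrite <- comp_assoc, (comp_cong_r1 f1), comp_id_l.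
- now rewrite <- comp_assoc, (comp_cong_r1 g2), comp_id_l.
Qed.

Lemma is_iso_fmap (C D : Category) (F : Functor C D) (a b : C) (f : Hom a b) :
  is_iso f -> is_iso (fmap F f).
Proof.
intros [g [h1 h2]]; exists (fmap F g).
now rewrite <- !fmap_comp, h1, h2, !fmap_id.
Qed.

Lemma mtmor_comp_l (M : MonoidalCategory) (a a' a'' b : M)
    (f' : Hom a' a'') (f : Hom a a') :
  mtmor (f' ∘ f) (idm b) = mtmor f' (idm b) ∘ mtmor f (idm b).
Proof. now rewrite <- mtmor_comp, comp_id_l. Qed.

Lemma mtmor_comp_r (M : MonoidalCategory) (a b b' b'' : M)
    (f' : Hom b' b'') (f : Hom b b') :
  mtmor (idm a) (f' ∘ f) = mtmor (idm a) f' ∘ mtmor (idm a) f.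
Proof. now rewrite <- mtmor_comp, comp_id_l. Qed.

Definition mon_id (M : MonoidalCategory) : MonFunctor M M.
Proof.
refine {| mfun := functor_id M; mstrong := {|
  smul := (fun a b => idm (mten a b)) :
    forall a b, Hom (mten (functor_id M a) (functor_id M b))
                    (functor_id M (mten a b));
  sunit := idm (munit M) : Hom (munit M) (functor_id M (munit M)) |} |};
  simpl; intros;
  rewrite ?mtmor_id, ?comp_id_l, ?comp_id_r; auto using is_iso_idm.
Defined.

Definition mon_comp (L M N : MonoidalCategory)
    (G : MonFunctor M N) (F : MonFunctor L M) : MonFunctor L N.
Proof.
refine {| mfun := functor_comp G F; mstrong := {|
  smul := (fun a b => fmap G (smul (mstrong F) a b)
                        ∘ smul (mstrong G) (F a) (F b)) :
    forall a b, Hom (mten (functor_comp G F a) (functor_comp G F b))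
                    (functor_comp G F (mten a b));
  sunit := fmap G (sunit (mstrong F)) ∘ sunit (mstrong G) :
    Hom (munit N) (functor_comp G F (munit L)) |} |}; simpl.
- intros a b; apply is_iso_comp; [apply is_iso_fmap|]; apply smul_iso.
- apply is_iso_comp; [apply is_iso_fmap|]; apply sunit_iso.
- intros a a' b b' f g.
  rewrite <- comp_assoc, smul_nat, !comp_assoc, <- !fmap_comp.
  now rewrite smul_nat.
- intros a b c.
  rewrite mtmor_comp_l, mtmor_comp_r, <- !comp_assoc.
  rewrite <- (fmap_id G (F c)), <- (fmap_id G (F a)).
  rewrite (comp_cong_r (smul_nat (mstrong G) (smul (mstrong F) a b) (idm (F c)))).
  rewrite (comp_cong_r (smul_nat (mstrong G) (idm (F a)) (smul (mstrong F) b c))).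
  rewrite (fmap_id G (F c)), (fmap_id G (F a)).
  rewrite !comp_assoc, <- !fmap_comp.
  rewrite smul_assoc, fmap_comp, <- !comp_assoc.
  f_equal; rewrite !comp_assoc; apply smul_assoc.
- intros a.
  rewrite mtmor_comp_l, <- !comp_assoc, <- (fmap_id G (F a)).
  rewrite (comp_cong_r (smul_nat (mstrong G) (sunit (mstrong F)) (idm (F a)))).
  rewrite fmap_id, !comp_assoc, <- !fmap_comp, smul_lunit.
  apply smul_lunit.
- intros a.
  rewrite mtmor_comp_r, <- !comp_assoc, <- (fmap_id G (F a)).
  rewrite (comp_cong_r (smul_nat (mstrong G) (idm (F a)) (sunit (mstrong F)))).
  rewrite fmap_id, !comp_assoc, <- !fmap_comp, smul_runit.
  apply smul_runit.
Defined.

Record MonTrans (M N : MonoidalCategory) (F G : MonFunctor M N) := {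
  tapp :> forall a : M, Hom (F a) (G a);
  tapp_nat : forall (a b : M) (f : Hom a b),
    tapp b ∘ fmap F f = fmap G f ∘ tapp a;
  tapp_mul : forall a b : M,
    tapp (mten a b) ∘ smul (mstrong F) a b =
    smul (mstrong G) a b ∘ mtmor (tapp a) (tapp b);
  tapp_unit : tapp (munit M) ∘ sunit (mstrong F) = sunit (mstrong G)
}.

Definition transport_cell (D : Category) (F0 : D -> MonoidalCategory)
    (F1 : forall x y : D, Hom x y -> MonFunctor (F0 x) (F0 y))
    (x y : D) (f g : Hom x y) (e : f = g) (a : F0 x) :
    Hom (F1 x y f a) (F1 x y g a) :=
  match e in _ = g' return Hom (F1 x y f a) (F1 x y g' a) with
  | eq_refl => idm _
  end.

(* [MonCatPseudofunctor F1], for [F1] over [F0]: the structure turning the assignments [F0]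
   on objects and [F1] on morphisms into a pseudofunctor from the category
   [D], seen as a locally discrete 2-category, to the 2-category MonCat.
   MonCat being strict, the associators and unitors of the target are
   identities; those of the source are equations, which [F1] sends to
   [transport_cell]. *)
Record MonCatPseudofunctor (D : Category) (F0 : D -> MonoidalCategory)
    (F1 : forall x y : D, Hom x y -> MonFunctor (F0 x) (F0 y)) := {
  ps_unit : forall x : D, MonTrans (mon_id (F0 x)) (F1 x x (idm x));
  ps_comp : forall (x y z : D) (g : Hom y z) (f : Hom x y),
    MonTrans (mon_comp (F1 y z g) (F1 x y f)) (F1 x z (g ∘ f));
  ps_unit_iso : forall (x : D) (a : F0 x), is_iso (ps_unit x a);
  ps_comp_iso : forall (x y z : D) (g : Hom y z) (f : Hom x y) (a : F0 x),
    is_iso (ps_comp g f a);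
  ps_assoc : forall (w x y z : D)
      (h : Hom y z) (g : Hom x y) (f : Hom w x) (a : F0 w),
    transport_cell F1 (comp_assoc h g f) a
      ∘ ps_comp h (g ∘ f) a ∘ fmap (F1 y z h) (ps_comp g f a) =
    ps_comp (h ∘ g) f a ∘ ps_comp h g (F1 w x f a);
  ps_lunit : forall (x y : D) (f : Hom x y) (a : F0 x),
    transport_cell F1 (comp_id_l f) a
      ∘ ps_comp (idm y) f a ∘ ps_unit y (F1 x y f a) =
    idm (F1 x y f a);
  ps_runit : forall (x y : D) (f : Hom x y) (a : F0 x),
    transport_cell F1 (comp_id_r f) a
      ∘ ps_comp f (idm x) a ∘ fmap (F1 x y f) (ps_unit x a) =
    idm (F1 x y f a)
}.

(* Main.v *)
From Stdlib Require Import IndefiniteDescription.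
Require Import Defs.

(** Parallel morphisms into an apex, or into a tensor product, are equal as soon
    as their projections agree, so only the existence of the structural
    morphisms has to be established. Associativity of [⊗] and the comparison
    [∇_p u ⊗ ∇_p v ≅ ∇_p (u ⊗ v)] both come from the binary axiom, by
    reassociating iterated squares while keeping track of the three projections.
    A comparison satisfying [F π_i ∘ μ = π_i] makes a functor strong
    monoidal, and any natural transformation between two such functors is
    monoidal when the target unit is subterminal; the unit of a slice is. *)

Set Implicit Arguments.
Unset Strict Implicit.
Unset Printing Implicit Defensive.

Local Open Scope cat_scope.

(** * Isomorphisms, and isomorphisms of spans with three legs *)

Section CategoryIso.

Variable C : Category.

Lemma iso_inverse (a b : C) (f : Hom a b) :
  is_iso f ->
  exists g : Hom b a, is_iso g /\ f ∘ g = idm b /\ g ∘ f = idm a.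
Proof.
intros [g [fg gf]]; exists g; repeat split; trivial.
now exists f.
Qed.

Lemma is_identity_iso (a b : C) (f : Hom a b) : is_identity f -> is_iso f.
Proof. intros []; apply is_iso_idm. Qed.

(** Remembering all three legs lets each reassociation be an isolated link: links invert and
    compose, and the composite still respects the projections. *)
Definition span3_iso (A B D P Q : C) (p1 : Hom P A) (p2 : Hom P B)
    (p3 : Hom P D) (q1 : Hom Q A) (q2 : Hom Q B) (q3 : Hom Q D) : Prop :=
  exists i : Hom P Q, is_iso i /\ q1 ∘ i = p1 /\ q2 ∘ i = p2 /\ q3 ∘ i = p3.

Lemma span3_iso_sym (A B D P Q : C) (p1 : Hom P A) (p2 : Hom P B)
    (p3 : Hom P D) (q1 : Hom Q A) (q2 : Hom Q B) (q3 : Hom Q D) :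
  span3_iso p1 p2 p3 q1 q2 q3 -> span3_iso q1 q2 q3 p1 p2 p3.
Proof.
intros [i [[j [ij ji]] [<- [<- <-]]]]; exists j; split; [now exists i|].
now rewrite <- !comp_assoc, ij, !comp_id_r.
Qed.

Lemma span3_iso_trans (A B D P Q R : C) (p1 : Hom P A) (p2 : Hom P B)
    (p3 : Hom P D) (q1 : Hom Q A) (q2 : Hom Q B) (q3 : Hom Q D)
    (r1 : Hom R A) (r2 : Hom R B) (r3 : Hom R D) :
  span3_iso p1 p2 p3 q1 q2 q3 -> span3_iso q1 q2 q3 r1 r2 r3 ->
  span3_iso p1 p2 p3 r1 r2 r3.
Proof.
intros [i [isoi [<- [<- <-]]]] [j [isoj [<- [<- <-]]]].
exists (j ∘ i); rewrite !comp_assoc; auto using is_iso_comp.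
Qed.

End CategoryIso.

(** * Isomorphisms and the subterminal unit of a slice *)

Section SliceIso.

Variables (E : Category) (B : E).

Lemma slice_is_iso (u v : Slice B) (s : Hom u v) : is_iso (mor s) -> is_iso s.
Proof.
intros [g [sg gs]].
assert (g_over : arr u ∘ g = arr v).
{ now rewrite <- (mor_over s), <- comp_assoc, sg, comp_id_r. }
exists (Build_SliceHom g_over); split; now apply SliceHom_eq.
Qed.

Lemma mor_is_iso (u v : Slice B) (s : Hom u v) : is_iso s -> is_iso (mor s).
Proof.
intros [g [sg gs]]; exists (mor g); split.
- exact (f_equal (fun t : SliceHom v v => mor t) sg).
- exact (f_equal (fun t : SliceHom u u => mor t) gs).
Qed.

Lemma slice_id_subterminal (u : Slice B) (s t : Hom u (slice_id B)) : s = t.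
Proof.
apply SliceHom_eq.
rewrite <- (comp_id_l (mor s)), <- (comp_id_l (mor t)).
exact (eq_trans (mor_over s) (eq_sym (mor_over t))).
Qed.

End SliceIso.

(** * Associativity, units and functoriality of chosen squares *)

Section Squares.

Variables (E : Category) (T : LocallySubcartesian E).

Section Chain.

Variables (A B D X : E) (a : Hom A X) (b : Hom B X) (c : Hom D X).

Local Notation sba := (sq T b a).
Local Notation scb := (sq T c b).
Local Notation sbc := (sq T b c).

(* The spans below list their legs in the order [D], [B], [A]. *)
Lemma sq_outer_sym :
  span3_iso
    (pr1 (sq T c (b ∘ pr1 sba)))
    (pr1 sba ∘ pr2 (sq T c (b ∘ pr1 sba)))
    (pr2 sba ∘ pr2 (sq T c (b ∘ pr1 sba)))
    (pr2 (sq T (b ∘ pr1 sba) c))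
    (pr1 sba ∘ pr1 (sq T (b ∘ pr1 sba) c))
    (pr2 sba ∘ pr1 (sq T (b ∘ pr1 sba) c)).
Proof.
destruct (sq_symmetry T c (b ∘ pr1 sba)) as [i [isoi [i1 i2]]].
exists i; rewrite <- !comp_assoc, i1, i2; auto.
Qed.

Lemma sq_binary_left :
  span3_iso
    (pr2 sbc ∘ pr2 (sq T (pr1 sba) (pr1 sbc)))
    (pr1 sba ∘ pr1 (sq T (pr1 sba) (pr1 sbc)))
    (pr2 sba ∘ pr1 (sq T (pr1 sba) (pr1 sbc)))
    (pr2 (sq T (b ∘ pr1 sba) c))
    (pr1 sba ∘ pr1 (sq T (b ∘ pr1 sba) c))
    (pr2 sba ∘ pr1 (sq T (b ∘ pr1 sba) c)).
Proof.
destruct (sq_binary T (pr1 sba) b c) as [i [isoi [i1 i2]]].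
exists i; rewrite <- !comp_assoc, i1, i2; auto.
Qed.

(** The symmetry exchanging [b] and [c] is an isomorphism over [B], and the functor [nabla] along
    [pr1 sba] preserves it. *)
Lemma sq_inner_sym :
  span3_iso
    (pr2 sbc ∘ pr2 (sq T (pr1 sba) (pr1 sbc)))
    (pr1 sba ∘ pr1 (sq T (pr1 sba) (pr1 sbc)))
    (pr2 sba ∘ pr1 (sq T (pr1 sba) (pr1 sbc)))
    (pr1 scb ∘ pr2 (sq T (pr1 sba) (pr2 scb)))
    (pr1 sba ∘ pr1 (sq T (pr1 sba) (pr2 scb)))
    (pr2 sba ∘ pr1 (sq T (pr1 sba) (pr2 scb))).
Proof.
destruct (sq_symmetry T b c) as [k [isok [k1 k2]]].
pose (h := Build_SliceObj (pr1 sbc) : Slice B).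
pose (h1 := Build_SliceObj (pr2 scb) : Slice B).
pose (u := @Build_SliceHom E B h h1 k k2 : @Hom (Slice B) h h1).
exists (nabla_mor T (pr1 sba) u).
pose proof (nabla_mor_pr1 T (pr1 sba) u) as e1.
pose proof (nabla_mor_pr2 T (pr1 sba) u) as e2.
simpl in e1, e2; split.
- apply (mor_is_iso (s := fmap (nabla T (pr1 sba)) u)), is_iso_fmap.
  now apply slice_is_iso.
- rewrite <- !comp_assoc, e1, e2; repeat split.
  now rewrite comp_assoc, k1.
Qed.

Lemma sq_nested_sym :
  span3_iso
    (pr1 scb ∘ pr2 (sq T (pr1 sba) (pr2 scb)))
    (pr1 sba ∘ pr1 (sq T (pr1 sba) (pr2 scb)))
    (pr2 sba ∘ pr1 (sq T (pr1 sba) (pr2 scb)))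
    (pr1 scb ∘ pr1 (sq T (pr2 scb) (pr1 sba)))
    (pr1 sba ∘ pr2 (sq T (pr2 scb) (pr1 sba)))
    (pr2 sba ∘ pr2 (sq T (pr2 scb) (pr1 sba))).
Proof.
destruct (sq_symmetry T (pr1 sba) (pr2 scb)) as [i [isoi [i1 i2]]].
exists i; rewrite <- !comp_assoc, i1, i2; auto.
Qed.

Lemma sq_binary_right :
  span3_iso
    (pr1 scb ∘ pr1 (sq T (pr2 scb) (pr1 sba)))
    (pr1 sba ∘ pr2 (sq T (pr2 scb) (pr1 sba)))
    (pr2 sba ∘ pr2 (sq T (pr2 scb) (pr1 sba)))
    (pr1 scb ∘ pr1 (sq T (c ∘ pr1 scb) a))
    (pr2 scb ∘ pr1 (sq T (c ∘ pr1 scb) a))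
    (pr2 (sq T (c ∘ pr1 scb) a)).
Proof.
(* Commutativity rewrites [c ∘ pr1 scb] as [b ∘ pr2 scb], a composite through [b], to which the
   binary axiom applies. *)
rewrite (square_comm scb).
destruct (sq_binary T (pr2 scb) b a) as [i [isoi [i1 i2]]].
exists i.
rewrite <- !comp_assoc, i1, i2, <- (square_comm (sq T (pr2 scb) (pr1 sba))); auto.
Qed.

(** The binary axiom treats base change along a composite, so each bracketing is brought into a form
    along a composite through [b]. Both then reduce to the square over [B] built from the products
    of [b] with [a] and of [c] with [b], up to symmetries. *)
Lemma sq_assoc_exists :
  span3_iso
    (pr1 (sq T c (b ∘ pr1 sba)))
    (pr1 sba ∘ pr2 (sq T c (b ∘ pr1 sba)))
    (pr2 sba ∘ pr2 (sq T c (b ∘ pr1 sba)))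
    (pr1 scb ∘ pr1 (sq T (c ∘ pr1 scb) a))
    (pr2 scb ∘ pr1 (sq T (c ∘ pr1 scb) a))
    (pr2 (sq T (c ∘ pr1 scb) a)).
Proof.
eapply span3_iso_trans; [apply sq_outer_sym|].
eapply span3_iso_trans; [apply span3_iso_sym, sq_binary_left|].
eapply span3_iso_trans; [apply sq_inner_sym|].
eapply span3_iso_trans; [apply sq_nested_sym|apply sq_binary_right].
Qed.

(* Base change along [c] of the product of [a] and [b] over [X] is the product
   over [D] of the base changes. *)
Lemma sq_base_change_exists :
  span3_iso
    (pr1 scb ∘ pr1 (sq T (pr1 scb) (pr1 (sq T c a))))
    (pr2 scb ∘ pr1 (sq T (pr1 scb) (pr1 (sq T c a))))
    (pr2 (sq T c a) ∘ pr2 (sq T (pr1 scb) (pr1 (sq T c a))))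
    (pr1 (sq T c (b ∘ pr1 sba)))
    (pr1 sba ∘ pr2 (sq T c (b ∘ pr1 sba)))
    (pr2 sba ∘ pr2 (sq T c (b ∘ pr1 sba))).
Proof.
eapply span3_iso_trans; [|apply span3_iso_sym, sq_assoc_exists].
(* The binary axiom gives $(D\otimes_X B)\otimes_D(D\otimes_X A)\cong(D\otimes_X B)\otimes_X A$;
   associativity read backwards does the rest. *)
destruct (sq_binary T (pr1 scb) c a) as [i [isoi [i1 i2]]].
exists i; rewrite <- !comp_assoc, i1, i2; auto.
Qed.

End Chain.

(** By the nullary axiom the first projection is an identity, and [i] is its inverse. Commutativity
    of the square then forces the second projection to be [f]. *)
Lemma sq_unit_r_exists (A X : E) (f : Hom A X) :
  exists i : Hom A (apex (sq T f (idm X))),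
    is_iso i /\ pr1 (sq T f (idm X)) ∘ i = idm A /\
    pr2 (sq T f (idm X)) ∘ i = f.
Proof.
destruct (iso_inverse (is_identity_iso
  (sq_nullary T f (is_identity_idm X)))) as [i [isoi [i1 _]]].
exists i; repeat split; trivial.
rewrite <- (comp_id_l (pr2 _)), <- (square_comm (sq T f (idm X))).
now rewrite <- comp_assoc, i1, comp_id_r.
Qed.

Lemma sq_unit_l_exists (A X : E) (f : Hom A X) :
  exists i : Hom A (apex (sq T (idm X) f)),
    is_iso i /\ pr1 (sq T (idm X) f) ∘ i = f /\
    pr2 (sq T (idm X) f) ∘ i = idm A.
Proof.
destruct (sq_unit_r_exists f) as [i [isoi [i1 i2]]].
destruct (sq_symmetry T f (idm X)) as [j [isoj [j1 j2]]].
exists (j ∘ i); rewrite !comp_assoc, j1, j2; auto using is_iso_comp.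
Qed.

(** Base change is functorial in the second leg only. To vary the first leg as well, a second base
    change is placed between two symmetries. *)
Lemma sq_mor_exists (A A' B B' X : E) (f : Hom A X) (f' : Hom A' X)
    (g : Hom B X) (g' : Hom B' X) (s : Hom A A') (t : Hom B B') :
  f' ∘ s = f -> g' ∘ t = g ->
  exists m : Hom (apex (sq T f g)) (apex (sq T f' g')),
    pr1 (sq T f' g') ∘ m = s ∘ pr1 (sq T f g) /\
    pr2 (sq T f' g') ∘ m = t ∘ pr2 (sq T f g).
Proof.
intros es et.
pose (of := Build_SliceObj f : Slice X).
pose (of' := Build_SliceObj f' : Slice X).
pose (og := Build_SliceObj g : Slice X).
pose (og' := Build_SliceObj g' : Slice X).
destruct (nabla_mor_exists T f
  (@Build_SliceHom E X og og' t et : @Hom (Slice X) og og')) as [m [m1 m2]].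
destruct (nabla_mor_exists T g'
  (@Build_SliceHom E X of of' s es : @Hom (Slice X) of of')) as [n [n1 n2]].
destruct (sq_symmetry T f g') as [i [_ [i1 i2]]].
destruct (sq_symmetry T g' f') as [j [_ [j1 j2]]].
simpl in *.
exists (j ∘ (n ∘ (i ∘ m))); split.
- rewrite comp_assoc, j1, comp_assoc, n2, <- comp_assoc, (comp_assoc (pr2 _)).
  now rewrite i2, m1.
- now rewrite comp_assoc, j2, comp_assoc, n1, comp_assoc, i1, m2.
Qed.

End Squares.

(** * The subcartesian monoidal structure of a slice *)

Section SliceMonoidal.

Variables (E : Category) (T : LocallySubcartesian E) (B : E).

Definition slice_tensor (u v : Slice B) : Slice B :=
  Sigma (arr v) (nabla T (arr v) u).

(** The order is reversed: [Sigma (arr v) (nabla T (arr v) u)] lives on the chosen square of [arr v]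
    and [arr u], so the first tensor projection is the second projection of the square. *)
Definition slice_pi1 (u v : Slice B) : Hom (slice_tensor u v) u :=
  @Build_SliceHom E B (slice_tensor u v) u (pr2 (sq T (arr v) (arr u)))
    (eq_sym (square_comm (sq T (arr v) (arr u)))).

Definition slice_pi2 (u v : Slice B) : Hom (slice_tensor u v) v :=
  @Build_SliceHom E B (slice_tensor u v) v (pr1 (sq T (arr v) (arr u))) eq_refl.

Lemma slice_pi_monic (u v : Slice B) :
  jointly_monic (slice_pi1 u v) (slice_pi2 u v).
Proof.
intros w s t e1 e2; apply SliceHom_eq.
apply (square_monic (s := sq T (arr v) (arr u))).
- exact (f_equal (fun x : SliceHom _ _ => mor x) e2).
- exact (f_equal (fun x : SliceHom _ _ => mor x) e1).
Qed.

Lemma slice_tmor_exists (u u' v v' : Slice B) (s : Hom u u') (t : Hom v v') :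
  exists m : Hom (slice_tensor u v) (slice_tensor u' v'),
    slice_pi1 u' v' ∘ m = s ∘ slice_pi1 u v /\
    slice_pi2 u' v' ∘ m = t ∘ slice_pi2 u v.
Proof.
destruct (sq_mor_exists T (mor_over t) (mor_over s)) as [m [m1 m2]].
unshelve eexists.
- refine (@Build_SliceHom E B (slice_tensor u v) (slice_tensor u' v') m _); simpl.
  now rewrite <- comp_assoc, m1, comp_assoc, mor_over.
- split; now apply SliceHom_eq.
Qed.

Lemma slice_theta_exists (u : Slice B) :
  exists m : Hom u (slice_tensor u (slice_id B)),
    is_iso m /\ slice_pi1 u (slice_id B) ∘ m = idm u.
Proof.
destruct (sq_unit_l_exists T (arr u)) as [i [isoi [i1 i2]]].
unshelve eexists.
- refine (@Build_SliceHom E B u (slice_tensor u (slice_id B)) i _); simpl.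
  now rewrite comp_id_l.
- split; [now apply slice_is_iso | now apply SliceHom_eq].
Qed.

Lemma slice_phi_exists (u : Slice B) :
  exists m : Hom u (slice_tensor (slice_id B) u),
    is_iso m /\ slice_pi2 (slice_id B) u ∘ m = idm u.
Proof.
destruct (sq_unit_r_exists T (arr u)) as [i [isoi [i1 i2]]].
unshelve eexists.
- refine (@Build_SliceHom E B u (slice_tensor (slice_id B) u) i _); simpl.
  now rewrite <- comp_assoc, i1, comp_id_r.
- split; [now apply slice_is_iso | now apply SliceHom_eq].
Qed.

(** The three component equations are what the span isomorphism delivers directly, its legs being
    listed as [w], [v], [u]. The associator axioms, phrased with [tmor], are recovered from them
    later. *)
Lemma slice_alpha_exists (u v w : Slice B) :
  exists m : Hom (slice_tensor (slice_tensor u v) w)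
                 (slice_tensor u (slice_tensor v w)),
    is_iso m /\
    slice_pi1 u (slice_tensor v w) ∘ m =
      slice_pi1 u v ∘ slice_pi1 (slice_tensor u v) w /\
    slice_pi1 v w ∘ (slice_pi2 u (slice_tensor v w) ∘ m) =
      slice_pi2 u v ∘ slice_pi1 (slice_tensor u v) w /\
    slice_pi2 v w ∘ (slice_pi2 u (slice_tensor v w) ∘ m) =
      slice_pi2 (slice_tensor u v) w.
Proof.
destruct (sq_assoc_exists T (arr u) (arr v) (arr w)) as [i [isoi [i1 [i2 i3]]]].
unshelve eexists.
- refine (@Build_SliceHom E B (slice_tensor (slice_tensor u v) w)
            (slice_tensor u (slice_tensor v w)) i _); simpl.
  now rewrite <- i1, !comp_assoc.
- split; [now apply slice_is_iso|].
  repeat split; apply SliceHom_eq; simpl; now rewrite ?comp_assoc.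
Qed.

Lemma slice_gamma_exists (u v : Slice B) :
  exists m : Hom (slice_tensor u v) (slice_tensor v u),
    is_iso m /\ slice_pi1 v u ∘ m = slice_pi2 u v /\
    slice_pi2 v u ∘ m = slice_pi1 u v.
Proof.
destruct (sq_symmetry T (arr v) (arr u)) as [i [isoi [i1 i2]]].
unshelve eexists.
- refine (@Build_SliceHom E B (slice_tensor u v) (slice_tensor v u) i _); simpl.
  rewrite <- comp_assoc, i1; symmetry; apply square_comm.
- split; [now apply slice_is_iso|]; split; now apply SliceHom_eq.
Qed.

Definition slice_tmor_sig (u u' v v' : Slice B) (s : Hom u u') (t : Hom v v') :=
  constructive_indefinite_description _ (slice_tmor_exists s t).
Definition slice_theta_sig (u : Slice B) :=
  constructive_indefinite_description _ (slice_theta_exists u).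
Definition slice_phi_sig (u : Slice B) :=
  constructive_indefinite_description _ (slice_phi_exists u).
Definition slice_alpha_sig (u v w : Slice B) :=
  constructive_indefinite_description _ (slice_alpha_exists u v w).
Definition slice_gamma_sig (u v : Slice B) :=
  constructive_indefinite_description _ (slice_gamma_exists u v).

Definition slice_monoidal :
  SubcartesianMonoidal
    (fun u v : Slice B => Sigma (arr v) (nabla T (arr v) u)) (slice_id B).
Proof.
pose proof (fun u u' v v' s t => proj2_sig (@slice_tmor_sig u u' v v' s t)) as et.
pose proof (fun u v w => proj2_sig (slice_alpha_sig u v w)) as ea.
pose proof (fun u v => proj2_sig (slice_gamma_sig u v)) as eg.
refine (@Build_SubcartesianMonoidal (Slice B) slice_tensor (slice_id B)
  (fun u u' v v' s t => proj1_sig (@slice_tmor_sig u u' v v' s t)) _ _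
  slice_pi1 slice_pi2
  (fun u => proj1_sig (slice_theta_sig u))
  (fun u => proj1_sig (slice_phi_sig u))
  (fun u v w => proj1_sig (slice_alpha_sig u v w))
  (fun u v => proj1_sig (slice_gamma_sig u v))
  (fun u => proj1 (proj2_sig (slice_theta_sig u)))
  (fun u => proj1 (proj2_sig (slice_phi_sig u)))
  (fun u v w => proj1 (ea u v w))
  (fun u v => proj1 (eg u v))
  slice_pi_monic
  (fun u u' v v' s t => proj1 (et u u' v v' s t))
  (fun u u' v v' s t => proj2 (et u u' v v' s t))
  (fun u => proj2 (proj2_sig (slice_theta_sig u)))
  (fun u => proj2 (proj2_sig (slice_phi_sig u)))
  _ _
  (fun u v => proj1 (proj2 (eg u v)))
  (fun u v => proj2 (proj2 (eg u v)))).
(* What remains is the functoriality of the tensor and the two projection axioms of the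
   associator. *)
- intros u v; destruct (et _ _ _ _ (idm u) (idm v)) as [e1 e2].
  apply slice_pi_monic; [rewrite e1|rewrite e2]; now rewrite comp_id_l, comp_id_r.
- intros u u' u'' v v' v'' s' s t' t.
  destruct (et _ _ _ _ (s' ∘ s) (t' ∘ t)) as [e1 e2].
  destruct (et _ _ _ _ s t) as [f1 f2].
  destruct (et _ _ _ _ s' t') as [g1 g2].
  apply slice_pi_monic.
  + now rewrite e1, comp_assoc, g1, <- !comp_assoc, f1.
  + now rewrite e2, comp_assoc, g2, <- !comp_assoc, f2.
- intros u v w; destruct (ea u v w) as [_ [a1 [a2 a3]]].
  destruct (et _ _ _ _ (idm u) (slice_pi1 v w)) as [e1 e2].
  apply slice_pi_monic.
  + now rewrite comp_assoc, e1, comp_id_l, a1.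
  + now rewrite comp_assoc, e2, <- comp_assoc, a2.
- intros u v w; destruct (ea u v w) as [_ [a1 [a2 a3]]].
  destruct (et _ _ _ _ (slice_pi2 u v) (idm w)) as [e1 e2].
  apply slice_pi_monic.
  + now rewrite e1, a2.
  + now rewrite e2, comp_id_l, a3.
Defined.

End SliceMonoidal.

(** * Projection-preserving functors between subcartesian monoidal categories *)

Section ProjectionPreserving.

Variables (C D : Category) (tC : C -> C -> C) (IC : C) (tD : D -> D -> D) (ID : D).
Variables (SC : SubcartesianMonoidal tC IC) (SD : SubcartesianMonoidal tD ID).

Definition preserves_projections (F : Functor C D)
    (mu : forall a b, Hom (tD (F a) (F b)) (F (tC a b))) : Prop :=
  forall a b,
    fmap F (pi1 SC a b) ∘ mu a b = pi1 SD (F a) (F b) /\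
    fmap F (pi2 SC a b) ∘ mu a b = pi2 SD (F a) (F b).

(** Through the isomorphism [mu], the images of the projections become the projections of [D], which
    are jointly monic. *)
Lemma fmap_pi_monic (F : Functor C D)
    (mu : forall a b, Hom (tD (F a) (F b)) (F (tC a b))) :
  (forall a b, is_iso (mu a b)) -> preserves_projections mu ->
  forall a b, jointly_monic (fmap F (pi1 SC a b)) (fmap F (pi2 SC a b)).
Proof.
intros mu_iso mu_pi a b z s t e1 e2.
destruct (mu_iso a b) as [nu [mn nm]], (mu_pi a b) as [p1 p2].
rewrite <- (comp_id_l s), <- (comp_id_l t), <- mn, <- !comp_assoc; f_equal.
apply (pi_monic (s := SD)).
- rewrite <- p1, <- !comp_assoc, !(comp_cong_r1 mn), !comp_id_l; exact e1.
- rewrite <- p2, <- !comp_assoc, !(comp_cong_r1 mn), !comp_id_l; exact e2.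
Qed.

(** Naturality and associativity are tested against images of projections. The unit laws hold for
    any isomorphism [eta]: the unitors are projections, and by naturality they discard the factor on
    which [eta] acts. *)
Definition strong_of_projections (F : Functor C D)
    (mu : forall a b, Hom (tD (F a) (F b)) (F (tC a b)))
    (mu_iso : forall a b, is_iso (mu a b))
    (mu_pi : preserves_projections mu)
    (eta : Hom ID (F IC)) (eta_iso : is_iso eta) :
  @StrongMonoidal (monoidal_of SC) (monoidal_of SD) F.
Proof.
pose proof (fmap_pi_monic mu_iso mu_pi) as monic.
pose proof (fun a b => proj1 (mu_pi a b)) as mu1.
pose proof (fun a b => proj2 (mu_pi a b)) as mu2.
refine (@Build_StrongMonoidal (monoidal_of SC) (monoidal_of SD) F
  mu eta mu_iso eta_iso _ _ _ _); simpl.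
- intros a a' b b' f g; apply monic.
  + rewrite comp_assoc, mu1, pi1_nat, comp_assoc, <- fmap_comp, pi1_nat.
    now rewrite fmap_comp, <- comp_assoc, mu1.
  + rewrite comp_assoc, mu2, pi2_nat, comp_assoc, <- fmap_comp, pi2_nat.
    now rewrite fmap_comp, <- comp_assoc, mu2.
- intros a b c.
  assert (Falpha1 : fmap F (pi1 SC a (tC b c)) ∘ fmap F (alpha SC a b c) =
      fmap F (pi1 SC a b) ∘ fmap F (pi1 SC (tC a b) c)).
  { now rewrite <- !fmap_comp, alpha_pr1. }
  assert (Falpha2 : fmap F (pi2 SC a (tC b c)) ∘ fmap F (alpha SC a b c) =
      fmap F (tmor SC (pi2 SC a b) (idm c))).
  { now rewrite <- fmap_comp, pi2_alpha. }
  assert (Fpi1 : fmap F (pi1 SC b c) ∘ fmap F (tmor SC (pi2 SC a b) (idm c)) =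
      fmap F (pi2 SC a b) ∘ fmap F (pi1 SC (tC a b) c)).
  { now rewrite <- !fmap_comp, pi1_nat. }
  assert (Fpi2 : fmap F (pi2 SC b c) ∘ fmap F (tmor SC (pi2 SC a b) (idm c)) =
      fmap F (pi2 SC (tC a b) c)).
  { now rewrite <- fmap_comp, pi2_nat, comp_id_l. }
  (* Using joint monicity twice splits the goal into its components in [F a], [F b] and [F c]; the
     four equations above carry the images of the projections past the image of the associator. *)
  rewrite <- !comp_assoc; apply monic; [|apply monic];
  repeat first
    [ rewrite (comp_cong_r Falpha1) | rewrite (comp_cong_r1 Falpha2)
    | rewrite (comp_cong_r Fpi1) | rewrite (comp_cong_r1 Fpi2)
    | rewrite (comp_cong_r1 (mu1 _ _)) | rewrite mu1
    | rewrite (comp_cong_r1 (mu2 _ _)) | rewrite mu2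
    | progress project ].
- intros a; rewrite mu2, pi2_nat; apply comp_id_l.
- intros a; rewrite mu1, pi1_nat; apply comp_id_l.
Defined.

Definition trans_of_projections
    (F G : MonFunctor (monoidal_of SC) (monoidal_of SD))
    (F_pi : @preserves_projections F (smul (mstrong F)))
    (G_pi : @preserves_projections G (smul (mstrong G)))
    (ID_subterminal : forall (z : D) (s t : Hom z ID), s = t)
    (t : forall a : C, @Hom D (F a) (G a))
    (t_nat : forall (a b : C) (f : Hom a b),
      @comp D _ _ _ (t b) (fmap F f) = @comp D _ _ _ (fmap G f) (t a)) :
  MonTrans F G.
Proof.
refine (@Build_MonTrans (monoidal_of SC) (monoidal_of SD) F G t t_nat _ _).
- intros a b; destruct (F_pi a b) as [f1 f2], (G_pi a b) as [g1 g2].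
  apply (fmap_pi_monic (smul_iso (mstrong G)) G_pi); simpl in *.
  + rewrite comp_assoc, <- t_nat, <- comp_assoc, f1, comp_assoc, g1.
    symmetry; apply pi1_nat.
  + rewrite comp_assoc, <- t_nat, <- comp_assoc, f2, comp_assoc, g2.
    symmetry; apply pi2_nat.
(* Factoring both sides through the unit isomorphism of [G] leaves two endomorphisms of [ID], equal
   by subterminality. *)
- destruct (sunit_iso (mstrong G)) as [r [gr rg]]; simpl in *.
  rewrite <- (comp_id_l (comp _ _)), <- gr, <- comp_assoc.
  rewrite <- (comp_id_r (sunit (mstrong G))) at 2.
  f_equal; apply ID_subterminal.
Defined.

End ProjectionPreserving.

(** Needed because the compositor of base change starts at a composite of strong monoidal functors,
    to which [trans_of_projections] must apply. *)
Lemma preserves_projections_comp (C D D' : Category)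
    (tC : C -> C -> C) (IC : C) (tD : D -> D -> D) (ID : D)
    (tD' : D' -> D' -> D') (ID' : D')
    (SC : SubcartesianMonoidal tC IC) (SD : SubcartesianMonoidal tD ID)
    (SD' : SubcartesianMonoidal tD' ID')
    (G : MonFunctor (monoidal_of SD) (monoidal_of SD'))
    (F : MonFunctor (monoidal_of SC) (monoidal_of SD)) :
  @preserves_projections _ _ _ _ _ _ SD SD' G (smul (mstrong G)) ->
  @preserves_projections _ _ _ _ _ _ SC SD F (smul (mstrong F)) ->
  @preserves_projections _ _ _ _ _ _ SC SD' (mon_comp G F)
    (smul (mstrong (mon_comp G F))).
Proof.
intros G_pi F_pi a b.
destruct (F_pi a b) as [f1 f2], (G_pi (F a) (F b)) as [g1 g2]; simpl in *.
rewrite !comp_assoc, <- !fmap_comp, f1, f2; auto.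
Qed.

Lemma preserves_projections_id (C : Category) (tC : C -> C -> C) (IC : C)
    (SC : SubcartesianMonoidal tC IC) :
  @preserves_projections _ _ _ _ _ _ SC SC (mon_id (monoidal_of SC))
    (smul (mstrong (mon_id (monoidal_of SC)))).
Proof. intros a b; split; apply comp_id_r. Qed.

(** * Base change as a pseudofunctor to monoidal categories *)

Section BaseChange.

Variables (E : Category) (T : LocallySubcartesian E).

Definition nabla_pr (X Y : E) (p : Hom X Y) (h : Slice Y) :
  Hom (dom (nabla T p h)) (dom h) := pr2 (sq T p (arr h)).

Lemma nabla_pr_fmap (X Y : E) (p : Hom X Y) (h h1 : Slice Y) (u : Hom h h1) :
  nabla_pr p h1 ∘ mor (fmap (nabla T p) u) = mor u ∘ nabla_pr p h.
Proof. apply nabla_mor_pr2. Qed.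

(** The first projection of the square is the structure map of [nabla T p h], on which morphisms
    over [X] agree automatically; only the second has to be compared. *)
Lemma nabla_hom_eq (X Y : E) (p : Hom X Y) (w : Slice X) (h : Slice Y)
    (s t : Hom w (nabla T p h)) :
  nabla_pr p h ∘ mor s = nabla_pr p h ∘ mor t -> s = t.
Proof.
intros e; apply SliceHom_eq.
apply (square_monic (s := sq T p (arr h))); [|exact e].
exact (eq_trans (mor_over s) (eq_sym (mor_over t))).
Qed.

Lemma nabla_smul_exists (X Y : E) (p : Hom X Y) (u v : Slice Y) :
  exists m : Hom (slice_tensor T (nabla T p u) (nabla T p v))
                 (nabla T p (slice_tensor T u v)),
    is_iso m /\
    fmap (nabla T p) (slice_pi1 T u v) ∘ m =
      slice_pi1 T (nabla T p u) (nabla T p v) /\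
    fmap (nabla T p) (slice_pi2 T u v) ∘ m =
      slice_pi2 T (nabla T p u) (nabla T p v).
Proof.
(* The leg to [X] says that [i] is a morphism over [X]; the legs to [dom v] and [dom u] give the
   second and first projection equations. *)
destruct (sq_base_change_exists T (arr u) (arr v) p) as [i [isoi [i1 [i2 i3]]]].
unshelve eexists.
- exact (@Build_SliceHom E X (slice_tensor T (nabla T p u) (nabla T p v))
    (nabla T p (slice_tensor T u v)) i i1).
- split; [now apply slice_is_iso|].
  split; apply nabla_hom_eq.
  + refine (eq_trans (comp_cong_r (nabla_pr_fmap p (slice_pi1 T u v)) i) _).
    exact (eq_trans (comp_assoc _ _ _) i3).
  + refine (eq_trans (comp_cong_r (nabla_pr_fmap p (slice_pi2 T u v)) i) _).
    exact (eq_trans (comp_assoc _ _ _) i2).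
Qed.

Lemma nabla_sunit_exists (X Y : E) (p : Hom X Y) :
  exists m : Hom (slice_id X) (nabla T p (slice_id Y)), is_iso m.
Proof.
destruct (sq_unit_r_exists T p) as [i [isoi [i1 _]]].
exists (@Build_SliceHom E X (slice_id X) (nabla T p (slice_id Y)) i i1).
now apply slice_is_iso.
Qed.

Lemma nabla_unit_exists (X : E) (h : Slice X) :
  exists m : Hom h (nabla T (idm X) h),
    is_iso m /\ nabla_pr (idm X) h ∘ mor m = idm (dom h).
Proof.
destruct (sq_unit_l_exists T (arr h)) as [i [isoi [i1 i2]]].
exists (@Build_SliceHom E X h (nabla T (idm X) h) i i1).
split; [now apply slice_is_iso | exact i2].
Qed.

(** This is the binary axiom read in the slice over [X]. The recorded equation determines the
    morphism, by [nabla_hom_eq]. *)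
Lemma nabla_comp_exists (X Y Z : E) (f : Hom X Y) (g : Hom Y Z) (h : Slice Z) :
  exists m : Hom (nabla T f (nabla T g h)) (nabla T (g ∘ f) h),
    is_iso m /\
    nabla_pr (g ∘ f) h ∘ mor m = nabla_pr g h ∘ nabla_pr f (nabla T g h).
Proof.
destruct (sq_binary T f g (arr h)) as [i [isoi [i1 i2]]].
exists (@Build_SliceHom E X (nabla T f (nabla T g h)) (nabla T (g ∘ f) h) i i1).
split; [now apply slice_is_iso | exact i2].
Qed.

Definition nabla_smul_sig (X Y : E) (p : Hom X Y) (u v : Slice Y) :=
  constructive_indefinite_description _ (nabla_smul_exists p u v).
Definition nabla_sunit_sig (X Y : E) (p : Hom X Y) :=
  constructive_indefinite_description _ (nabla_sunit_exists p).
Definition nabla_unit_sig (X : E) (h : Slice X) :=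
  constructive_indefinite_description _ (nabla_unit_exists h).
Definition nabla_comp_sig (X Y Z : E) (f : Hom X Y) (g : Hom Y Z) (h : Slice Z) :=
  constructive_indefinite_description _ (nabla_comp_exists f g h).

Definition nabla_unit (X : E) (h : Slice X) : Hom h (nabla T (idm X) h) :=
  proj1_sig (nabla_unit_sig h).
Definition nabla_comp (X Y Z : E) (f : Hom X Y) (g : Hom Y Z) (h : Slice Z) :
  Hom (nabla T f (nabla T g h)) (nabla T (g ∘ f) h) :=
  proj1_sig (nabla_comp_sig f g h).

Lemma nabla_pr_unit (X : E) (h : Slice X) :
  nabla_pr (idm X) h ∘ mor (nabla_unit h) = idm (dom h).
Proof. exact (proj2 (proj2_sig (nabla_unit_sig h))). Qed.

Lemma nabla_pr_comp (X Y Z : E) (f : Hom X Y) (g : Hom Y Z) (h : Slice Z) :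
  nabla_pr (g ∘ f) h ∘ mor (nabla_comp f g h) =
  nabla_pr g h ∘ nabla_pr f (nabla T g h).
Proof. exact (proj2 (proj2_sig (nabla_comp_sig f g h))). Qed.

Lemma nabla_unit_nat (X : E) (a b : Slice X) (s : Hom a b) :
  nabla_unit b ∘ s = fmap (nabla T (idm X)) s ∘ nabla_unit a.
Proof.
apply nabla_hom_eq.
change (nabla_pr (idm X) b ∘ (mor (nabla_unit b) ∘ mor s) =
  nabla_pr (idm X) b ∘ (mor (fmap (nabla T (idm X)) s) ∘ mor (nabla_unit a))).
rewrite (comp_cong_r1 (nabla_pr_unit b)), (comp_cong_r (nabla_pr_fmap _ s)).
now rewrite nabla_pr_unit, comp_id_l, comp_id_r.
Qed.

Lemma nabla_comp_nat (X Y Z : E) (f : Hom X Y) (g : Hom Y Z) (a b : Slice Z)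
    (s : Hom a b) :
  nabla_comp f g b ∘ fmap (nabla T f) (fmap (nabla T g) s) =
  fmap (nabla T (g ∘ f)) s ∘ nabla_comp f g a.
Proof.
apply nabla_hom_eq.
change (nabla_pr (g ∘ f) b ∘
    (mor (nabla_comp f g b) ∘ mor (fmap (nabla T f) (fmap (nabla T g) s))) =
  nabla_pr (g ∘ f) b ∘
    (mor (fmap (nabla T (g ∘ f)) s) ∘ mor (nabla_comp f g a))).
rewrite (comp_cong_r (nabla_pr_comp f g b)), (comp_cong_r (nabla_pr_fmap _ s)).
rewrite (nabla_pr_fmap f (fmap (nabla T g) s)), nabla_pr_comp.
apply (comp_cong_r (nabla_pr_fmap g s)).
Qed.

Definition nabla_strong (Y X : E) (p : Hom X Y) :
  @StrongMonoidal (monoidal_of (slice_monoidal T Y))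
    (monoidal_of (slice_monoidal T X)) (nabla T p) :=
  @strong_of_projections _ _ _ _ _ _ (slice_monoidal T Y) (slice_monoidal T X)
    (nabla T p)
    (fun u v => proj1_sig (nabla_smul_sig p u v))
    (fun u v => proj1 (proj2_sig (nabla_smul_sig p u v)))
    (fun u v => proj2 (proj2_sig (nabla_smul_sig p u v)))
    (proj1_sig (nabla_sunit_sig p))
    (proj2_sig (nabla_sunit_sig p)).

Definition nabla_mon (Y X : op E) (p : @Hom (op E) Y X) :
  MonFunctor (monoidal_of (slice_monoidal T Y))
    (monoidal_of (slice_monoidal T X)) :=
  @Build_MonFunctor (monoidal_of (slice_monoidal T Y))
    (monoidal_of (slice_monoidal T X)) (nabla T p) (nabla_strong p).

Lemma nabla_mon_preserves (Y X : E) (p : Hom X Y) :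
  @preserves_projections _ _ _ _ _ _ (slice_monoidal T Y) (slice_monoidal T X)
    (nabla_mon p) (smul (mstrong (nabla_mon p))).
Proof. intros u v; exact (proj2 (proj2_sig (nabla_smul_sig p u v))). Qed.

Definition nabla_unit_trans (X : E) :
  MonTrans (mon_id (monoidal_of (slice_monoidal T X)))
    (nabla_mon (idm X : @Hom (op E) X X)) :=
  @trans_of_projections _ _ _ _ _ _ (slice_monoidal T X) (slice_monoidal T X)
    (mon_id (monoidal_of (slice_monoidal T X)))
    (nabla_mon (idm X : @Hom (op E) X X))
    (preserves_projections_id (slice_monoidal T X))
    (nabla_mon_preserves (idm X))
    (@slice_id_subterminal E X)
    (@nabla_unit X)
    (@nabla_unit_nat X).

Definition nabla_comp_trans (X Y Z : E) (f : Hom X Y) (g : Hom Y Z) :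
  MonTrans (mon_comp (nabla_mon f) (nabla_mon g))
    (nabla_mon (g ∘ f : @Hom (op E) Z X)) :=
  @trans_of_projections _ _ _ _ _ _ (slice_monoidal T Z) (slice_monoidal T X)
    (mon_comp (nabla_mon f) (nabla_mon g))
    (nabla_mon (g ∘ f : @Hom (op E) Z X))
    (preserves_projections_comp (nabla_mon_preserves f) (nabla_mon_preserves g))
    (nabla_mon_preserves (g ∘ f))
    (@slice_id_subterminal E X)
    (nabla_comp f g)
    (@nabla_comp_nat X Y Z f g).

(** Transport along an equation of base morphisms is invisible to [nabla_pr], so the transport cells
    drop out of the coherence laws. *)
Lemma nabla_pr_transport (X Y : E) (f g : @Hom (op E) Y X) (e : f = g)
    (h : Slice Y) :
  nabla_pr g h ∘ mor (transport_cell nabla_mon e h) = nabla_pr f h.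
Proof. destruct e; apply comp_id_r. Qed.

(** Followed by the projection, both sides become the composite of the projections for [f], [g] and
    [k]. The equation [e] is kept arbitrary, so that the proof term from [op E] can be supplied
    later. *)
Lemma nabla_assoc (W X Y Z : E) (f : Hom W X) (g : Hom X Y) (k : Hom Y Z)
    (e : k ∘ g ∘ f = k ∘ (g ∘ f) :> @Hom (op E) Z W) (h : Slice Z) :
  nabla_pr (k ∘ (g ∘ f)) h ∘
    (mor (transport_cell nabla_mon e h) ∘ mor (nabla_comp f (k ∘ g) h) ∘
     mor (fmap (nabla T f) (nabla_comp g k h))) =
  nabla_pr (k ∘ (g ∘ f)) h ∘
    (mor (nabla_comp (g ∘ f) k h) ∘ mor (nabla_comp f g (nabla T k h))).
Proof.
rewrite <- comp_assoc, (comp_cong_r1 (nabla_pr_transport e h)).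
rewrite (comp_cong_r (nabla_pr_comp f (k ∘ g) h)), nabla_pr_fmap.
rewrite (comp_cong_r (nabla_pr_comp g k h)).
now rewrite (comp_cong_r (nabla_pr_comp (g ∘ f) k h)), nabla_pr_comp.
Qed.

(** A left unit in [op E] is precomposition with an identity in [E], hence the form of [e]. *)
Lemma nabla_lunit (X Y : E) (f : Hom X Y)
    (e : f ∘ idm X = f :> @Hom (op E) Y X) (h : Slice Y) :
  nabla_pr f h ∘
    (mor (transport_cell nabla_mon e h) ∘ mor (nabla_comp (idm X) f h) ∘
     mor (nabla_unit (nabla T f h))) =
  nabla_pr f h ∘ idm (dom (nabla T f h)).
Proof.
rewrite <- comp_assoc, (comp_cong_r1 (nabla_pr_transport e h)).
now rewrite (comp_cong_r (nabla_pr_comp (idm X) f h)), nabla_pr_unit.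
Qed.

Lemma nabla_runit (X Y : E) (f : Hom X Y)
    (e : idm Y ∘ f = f :> @Hom (op E) Y X) (h : Slice Y) :
  nabla_pr f h ∘
    (mor (transport_cell nabla_mon e h) ∘ mor (nabla_comp f (idm Y) h) ∘
     mor (fmap (nabla T f) (nabla_unit h))) =
  nabla_pr f h ∘ idm (dom (nabla T f h)).
Proof.
rewrite <- comp_assoc, (comp_cong_r1 (nabla_pr_transport e h)).
rewrite (comp_cong_r (nabla_pr_comp f (idm Y) h)), nabla_pr_fmap.
now rewrite (comp_cong_r1 (nabla_pr_unit h)), comp_id_l, comp_id_r.
Qed.

Definition nabla_pseudofunctor :
  @MonCatPseudofunctor (op E) (fun B : E => monoidal_of (slice_monoidal T B))
    nabla_mon.
Proof.
refine (@Build_MonCatPseudofunctor (op E)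
  (fun B : E => monoidal_of (slice_monoidal T B)) nabla_mon
  nabla_unit_trans
  (fun (Z Y X : E) (f : Hom X Y) (g : Hom Y Z) => nabla_comp_trans f g)
  (fun X h => proj1 (proj2_sig (nabla_unit_sig h)))
  (fun (Z Y X : E) (f : Hom X Y) (g : Hom Y Z) h =>
    proj1 (proj2_sig (nabla_comp_sig f g h)))
  _ _ _).
- intros Z Y X W f g k h; apply nabla_hom_eq; exact (nabla_assoc _ h).
- intros Y X f h; apply nabla_hom_eq; exact (nabla_lunit _ h).
- intros Y X f h; apply nabla_hom_eq; exact (nabla_runit _ h).
Defined.

End BaseChange.

(** The conjuncts beyond existence tie the tensor action, the projections and the cells of the
    pseudofunctor to the chosen squares; joint monicity makes the cells unique with these
    equations. *)
Theorem proposition3p2p1 (E : Category) (T : LocallySubcartesian E) :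
  exists S : forall B : E,
      SubcartesianMonoidal
        (fun u v : Slice B => Sigma (arr v) (nabla T (arr v) u))
        (slice_id B),
    (forall (B : E) (u u' v : Slice B) (a : Hom u u'),
       tmor (S B) a (idm v) = fmap (Sigma (arr v)) (fmap (nabla T (arr v)) a)) /\
    (forall (B : E) (u v : Slice B),
       mor (pi1 (S B) u v) = pr2 (sq T (arr v) (arr u))) /\
    (forall (B : E) (u v : Slice B),
       mor (pi2 (S B) u v) = pr1 (sq T (arr v) (arr u))) /\
    exists (m : forall (Y X : E) (p : @Hom E X Y),
              @StrongMonoidal (monoidal_of (S Y)) (monoidal_of (S X)) (nabla T p))
           (P : @MonCatPseudofunctor (op E)
                  (fun B : E => monoidal_of (S B))
                  (fun (Y X : E) (p : @Hom E X Y) =>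
                     @Build_MonFunctor (monoidal_of (S Y)) (monoidal_of (S X))
                       (nabla T p) (m Y X p))),
      (forall (X : E) (h : Slice X),
         comp (pr2 (sq T (idm X) (arr h))) (mor (ps_unit P X h)) =
         idm (dom h)) /\
      (forall (X Y Z : E) (f : @Hom E X Y) (g : @Hom E Y Z) (h : Slice Z),
         comp (pr2 (sq T (comp g f) (arr h)))
              (mor (@ps_comp _ _ _ P Z Y X f g h)) =
         comp (pr2 (sq T g (arr h)))
              (pr2 (sq T f (arr (nabla T g h))))).
Proof.
exists (slice_monoidal T); split; [|split; [|split]]; try reflexivity.
(* The tensor action was obtained by description, so it is identified with the action of [Sigma]
   after [nabla] through its two projections. *)
- intros B u u' v a; apply (slice_pi_monic (T := T)).
  + refine (eq_trans (pi1_nat (slice_monoidal T B) a (idm v)) _).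
    apply SliceHom_eq; symmetry; apply nabla_mor_pr2.
  + refine (eq_trans (pi2_nat (slice_monoidal T B) a (idm v)) _).
    rewrite comp_id_l; apply SliceHom_eq; symmetry; apply nabla_mor_pr1.
- exists (@nabla_strong E T), (@nabla_pseudofunctor E T); split.
  + intros X h; exact (nabla_pr_unit T h).
  + intros X Y Z f g h; exact (nabla_pr_comp T f g h).
Qed.
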